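(* The inequality $Z(G)\le \frac{3}{10}n$ does not hold for all connected claw-free cubic graphs of sufficiently large order $n$; that is, for every integer $N$ there exists a connected claw-free cubic graph $G$ with $n\ge N$ vertices such that $Z(G)>\frac{3}{10}\,n$.
   Context: All graphs are finite and simple. A graph is cubic if it is $3$-regular, and claw-free if it has no induced subgraph isomorphic to $K_{1,3}$. Zero forcing: start with a set $S\subseteq V(G)$ of colored vertices, all other vertices being uncolored. A colored vertex $v$ forces an uncolored neighbor $u$ to become colored if $u$ is the only uncolored neighbor of $v$. If iterating this rule colors all of $V(G)$, then $S$ is a zero forcing set. The zero forcing number $Z(G)$ is the minimum cardinality of a zero forcing set of $G$. *)

(* Defs.v *)
From HB Require Import structures.
From mathcomp Require Import all_boot all_order all_algebra.

Set Implicit Arguments.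
Unset Strict Implicit.
Unset Printing Implicit Defensive.

Record sgraph := SGraph {
  vertex :> finType;
  adj : rel vertex;
  adj_sym : symmetric adj;
  adj_irrefl : irreflexive adj }.

Definition nbr (G : sgraph) (v : G) : {set G} := [set u | adj v u].

Definition regular (k : nat) (G : sgraph) : Prop := forall v : G, #|nbr v| = k.

Definition cubic (G : sgraph) : Prop := regular 3 G.

(* The graph with no vertices does not count as connected. *)
Definition connected (G : sgraph) : Prop :=
  0 < #|G| /\ forall x y : G, connect (@adj G) x y.

Definition bip_adj (m n : nat) : rel ('I_m + 'I_n) :=
  fun x y => match x, y with
             | inl _, inr _ | inr _, inl _ => true
             | _, _ => false
             end.

Lemma bip_adj_sym m n : symmetric (@bip_adj m n).
Proof. by move=> [x|x] [y|y]. Qed.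

Lemma bip_adj_irrefl m n : irreflexive (@bip_adj m n).
Proof. by move=> [x|x]. Qed.

Definition complete_bipartite (m n : nat) : sgraph :=
  SGraph (@bip_adj_sym m n) (@bip_adj_irrefl m n).

(* H is isomorphic to the subgraph of G induced by the image of f. *)
Definition has_induced (H G : sgraph) : Prop :=
  exists f : H -> G, injective f /\ forall x y : H, adj (f x) (f y) = adj x y.

Definition claw_free (G : sgraph) : Prop :=
  ~ has_induced (complete_bipartite 1 3) G.

Section ZeroForcing.
Variable G : sgraph.
Implicit Types (S : {set G}) (u v : G).

Definition forces S v u : bool := (v \in S) && (nbr v :\: S == [set u]).

Definition force_step : rel {set G} := fun S S' =>
  [exists v, exists u, forces S v u && (S' == u |: S)].

Definition zero_forcing_set S : bool := connect force_step S [set: G].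

(* [set: G] is a zero forcing set, so the minimum below is attained. *)
Lemma zero_forcing_setT : zero_forcing_set [set: G].
Proof. exact: connect0. Qed.

Definition zero_forcing_number : nat :=
  #|[arg min_(S < [set: G] | zero_forcing_set S) #|S|]|.

End ZeroForcing.

(* Main.v *)
(** The graph is a caterpillar of [m] triangles in a row, with a copy of a
    7-vertex gadget (a triangle two of whose vertices are joined through a
    diamond) hung at each of the [m + 2] free ports, so that [n = 10 m + 14].
    If [A] is a matrix over F_2 whose off-diagonal part is the adjacency matrix,
    a kernel vector of [A] is determined by its values on a zero forcing set
    [S]: when [v] forces [u], the equation at [v] gives the value at [u].
    Hence [dim ker A <= Z].  For a suitable diagonal, the kernel consists of
    the F_2-flows on the caterpillar ([m + 1] free values, one for each spine
    edge), extended to the gadgets with two free values for each gadget; thus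
    [Z >= 3 m + 5 > 3 n / 10]. *)

Require Import Defs.
From mathcomp Require Import all_boot all_order all_algebra.
From mathcomp Require Import zify lra.

Set Implicit Arguments.
Unset Strict Implicit.
Unset Printing Implicit Defensive.

Import Order.TTheory GRing.Theory Num.Theory.
Local Open Scope ring_scope.

(** * Zero forcing and the counting bound *)

Lemma zero_forcing_numberP (G : sgraph) :
  exists2 S : {set G}, zero_forcing_set S & zero_forcing_number G = #|S|.
Proof.
rewrite /zero_forcing_number; case: arg_minnP => [|S zfS _].
  exact: zero_forcing_setT.
by exists S.
Qed.

(** Induction along the forcing sequence: when [v] forces [u], [v] and its other neighbors are
    already colored, so [f] and [g] agree there. *)
Lemma zero_forcing_eq (G : sgraph) (A : Type) (f g : G -> A) (S : {set G}) :
    (forall v u, adj v u -> f v = g v ->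
       (forall w, adj v w -> w != u -> f w = g w) -> f u = g u) ->
  zero_forcing_set S -> {in S, f =1 g} -> f =1 g.
Proof.
move=> fg_step /connectP [p].
elim: p S => [|S' p IH] S /=.
  by move=> _ <- fgS v; apply: fgS; rewrite inE.
case/andP=> /existsP [v /existsP [u /andP [/andP [vS /eqP Dv] /eqP DS']]].
move=> pth lst fgS; apply: IH pth lst _.
have fgu : f u = g u.
  apply: fg_step (fgS _ vS) _.
    by move/setP/(_ u): Dv; rewrite !inE eqxx => /andP [].
  move=> w vw nwu; apply: fgS; apply: contraT => wS.
  by move/setP/(_ w): Dv; rewrite !inE vw wS (negbTE nwu).
by rewrite DS' => w; rewrite !inE => /orP [/eqP ->|/fgS].
Qed.

(** Restricting the support of [phi t] to [S] is injective in [t]; counting subsets of [S] replaces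
    dimensions. *)
Lemma leq_card_zero_forcing (G : sgraph) (T : finType) (phi : T -> G -> bool)
    (S : {set G}) :
    (forall t t', phi t =1 phi t' -> t = t') ->
    (forall t t' v u, adj v u -> phi t v = phi t' v ->
       (forall w, adj v w -> w != u -> phi t w = phi t' w) ->
       phi t u = phi t' u) ->
  zero_forcing_set S -> (#|T| <= 2 ^ #|S|)%N.
Proof.
move=> phi_inj phi_step zfS.
pose r t : {set G} := [set v in S | phi t v].
have r_inj : injective r.
  move=> t t' /setP rtt'; apply: phi_inj; apply: (zero_forcing_eq _ zfS).
    by move=> v u; apply: phi_step.
  by move=> v vS; have := rtt' v; rewrite !inE vS.
rewrite -(card_imset predT r_inj) -card_powerset; apply: subset_leq_card.
by apply/subsetP=> _ /imsetP [t _ ->]; rewrite inE; apply/subsetP=> v /[!inE] /andP [].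
Qed.

(** * Local criteria for cubic and claw-free graphs *)

Lemma cubicP (G : sgraph) :
    (forall v : G, exists n1 n2 n3 : G,
       uniq [:: n1; n2; n3] /\ adj v =i [:: n1; n2; n3]) ->
  cubic G.
Proof.
move=> nbrs v; have [n1 [n2 [n3 [Un Dn]]]] := nbrs v.
rewrite -[RHS](card_uniqP Un); apply: eq_card => u.
by rewrite inE -Dn.
Qed.

(** The three leaves of a claw would exhaust the neighborhood of its center, which contains an
    edge. *)
Lemma cubic_claw_free (G : sgraph) :
    cubic G ->
    (forall v : G, exists u w, [/\ adj v u, adj v w & adj u w]) ->
  claw_free G.
Proof.
move=> cubG tri [f [f_inj fE]].
have [u [w [vu vw uw]]] := tri (f (inl ord0)).
pose h (i : 'I_3) := f (inr i).
have h_inj : injective h by move=> i j /f_inj [].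
have hN : h @: setT = nbr (f (inl ord0)).
  apply/eqP; rewrite eqEcard card_imset // cubG cardsT card_ord leqnn andbT.
  by apply/subsetP=> _ /imsetP [i _ ->]; rewrite inE fE.
have : u \in h @: setT by rewrite hN inE.
have : w \in h @: setT by rewrite hN inE.
by move=> /imsetP [i _ Dw] /imsetP [j _ Du]; move: uw; rewrite Du Dw fE.
Qed.

(** * The caterpillar graph *)

(* Positions in a spine triangle: [None] carries a gadget, [Some false] points
   to the left and [Some true] to the right. *)
Definition port : finType := option bool.

(* [None] is the vertex attached to the spine; for each side [s], [(s, None)]
   completes its triangle, [(s, Some false)] is an end of the diamond and
   [(s, Some true)] a vertex of the central edge of the diamond. *)
Definition gadget : finType := option (bool * option bool).

Definition gadget_adj (x y : gadget) : bool :=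
  match x, y with
  | None, Some (_, None) | Some (_, None), None => true
  | Some (s, None), Some (s', None) => s != s'
  | Some (s, None), Some (s', Some false)
  | Some (s, Some false), Some (s', None) => s == s'
  | Some (_, Some false), Some (_, Some true)
  | Some (_, Some true), Some (_, Some false) => true
  | Some (s, Some true), Some (s', Some true) => s != s'
  | _, _ => false
  end.

Section Caterpillar.
Variable m : nat.

Definition attached (i : nat) (p : port) (j : nat) : bool :=
  match p with
  | None => j == i.+1
  | Some false => (i == 0) && (j == 0)
  | Some true => (i.+1 == m) && (j == m.+1)
  end%N.

Definition spine_next (i j : nat) (p q : port) : bool :=
  [&& p == Some true, q == Some false & j == i.+1].

Definition cat_vertex : finType :=
  ('I_m * port + 'I_m.+2 * gadget)%type.

Definition cat_adj : rel cat_vertex := fun u v =>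
  match u, v with
  | inl (i, p), inl (j, q) =>
      [|| (i == j :> nat) && (p != q), spine_next i j p q | spine_next j i q p]
  | inl (i, p), inr (j, x) | inr (j, x), inl (i, p) =>
      (x == None) && attached i p j
  | inr (j, x), inr (k, y) => (j == k :> nat) && gadget_adj x y
  end.

Lemma cat_adj_sym : symmetric cat_adj.
Proof.
move=> [[i p]|[j x]] [[i' p']|[j' x']] //=.
  by rewrite [_ == nat_of_ord i]eq_sym [p == _]eq_sym; congr (_ || _); rewrite orbC.
rewrite [_ == nat_of_ord j]eq_sym; congr (_ && _).
by case: x x' => [[[] [[]|]]|] [[[] [[]|]]|].
Qed.

Lemma cat_adj_irrefl : irreflexive cat_adj.
Proof.
move=> [[i p]|[j x]] /=.
  by rewrite eqxx /= /spine_next; case: p => [[]|] /=.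
by rewrite eqxx; case: x => [[[] [[]|]]|].
Qed.

Definition caterpillar : sgraph := SGraph cat_adj_sym cat_adj_irrefl.

Lemma card_caterpillar : #|caterpillar| = (10 * m + 14)%N.
Proof.
rewrite card_sum !card_prod !card_option card_prod !card_option card_bool !card_ord.
lia.
Qed.

(** * The kernel vectors *)

(* One value for each spine edge, two for each gadget. *)
Definition param : finType :=
  ({ffun 'I_m.+1 -> bool} * {ffun 'I_m.+2 -> bool} * {ffun 'I_m.+2 -> bool})%type.

Lemma card_param : #|param| = (2 ^ (3 * m + 5))%N.
Proof.
by rewrite !card_prod !card_ffun card_bool !card_ord -!expnD; congr (2 ^ _)%N; lia.
Qed.

(* Spine edges are numbered from 1; edges 0 and m + 2 do not exist. *)
Definition flow (t : param) (i : nat) : bool :=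
  if i is k.+1 then if insub k is Some k' then t.1.1 k' else false else false.

Arguments flow : simpl never.

Lemma flowS t (i : 'I_m.+1) : flow t i.+1 = t.1.1 i.
Proof. by rewrite /flow valK. Qed.

Lemma flow_last t : flow t m.+2 = false.
Proof. by rewrite /flow insubF // ltnn. Qed.

(** The values on a spine triangle sum to zero, and joined ports of two triangles agree. A gadget
    with inflow f has 0 at its root and pairs a, a+f on the apexes, a+f, a on the diamond ends and
    d, d+f on the central edge; the swap at the ends makes the apex equations hold. *)
Definition kernel_vector (t : param) (v : caterpillar) : bool :=
  match v with
  | inl (i, None) => flow t i.+1 (+) flow t i.+2
  | inl (i, Some s) => flow t (s + i).+1
  | inr (j, None) => false
  | inr (j, Some (s, p)) =>
      (if p is Some true then t.2 j else t.1.2 j)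
      (+) (s (+) (p == Some false)) && (flow t j (+) flow t j.+1)
  end.

Lemma kernel_vector_inj t t' :
  (0 < m)%N -> kernel_vector t =1 kernel_vector t' -> t = t'.
Proof.
move=> m_gt0 eq_k.
case: t t' eq_k => [[s b] d] [[s' b'] d'] eq_k; congr (_, _, _); apply/ffunP => j.
- rewrite -[LHS](flowS (s, b, d)) -[RHS](flowS (s', b', d')).
  (* The last spine edge is on the left of no triangle; it is read off the right port of the last
     one. *)
  have [ltjm|lemj] := ltnP j m; first exact: eq_k (inl (Ordinal ltjm, Some false)).
  have ltm1 : (m.-1 < m)%N by rewrite prednK.
  have -> : nat_of_ord j = (true + Ordinal ltm1)%N.
    by rewrite /=; have := ltn_ord j; lia.
  exact: eq_k (inl (Ordinal ltm1, Some true)).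
- by have := eq_k (inr (j, Some (false, None))); rewrite /= !addbF.
- by have := eq_k (inr (j, Some (false, Some true))); rewrite /= !addbF.
Qed.

Lemma option_eqE (T : eqType) :
  ((forall x y : T, (Some x == Some y) = (x == y))
  * (forall x : T, (Some x == None) = false)
  * (forall x : T, (None == Some x) = false))%type.
Proof. by []. Qed.

Lemma cat_vertex_eqE :
  ((forall i i' (p p' : port),
     ((inl (i, p) : cat_vertex) == inl (i', p')) = (i == i' :> nat) && (p == p'))
  * (forall j j' (x x' : gadget),
     ((inr (j, x) : cat_vertex) == inr (j', x')) = (j == j' :> nat) && (x == x'))
  * (forall i (p : port) j (x : gadget),
     ((inl (i, p) : cat_vertex) == inr (j, x)) = false)
  * (forall i (p : port) j (x : gadget),
     ((inr (j, x) : cat_vertex) == inl (i, p)) = false))%type.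
Proof. by []. Qed.

(** The zero flow on the missing edges 0 and [m.+2] lets one inflow formula cover the end gadgets
    too. *)
Lemma gadget_attached (j : 'I_m.+2) : (0 < m)%N ->
  exists (i : 'I_m) (p : port),
    (forall (i' : 'I_m) p', attached i' p' j = (i' == i :> nat) && (p' == p)) /\
    (forall t, kernel_vector t (inl (i, p)) = flow t j (+) flow t j.+1).
Proof.
move=> m_gt0; case: j => [[|j] ltj].
  exists (Ordinal m_gt0), (Some false); split=> // i' p'.
  by case: p' => [[|]|]; rewrite /= ?option_eqE ?eqxx /=; lia.
have [ltjm|lemj] := ltnP j m.
  exists (Ordinal ltjm), None; split=> // i' p'; have := ltn_ord i'.
  by case: p' => [[|]|]; rewrite /= ?option_eqE ?eqxx /=; lia.
have jm : j = m by apply/eqP; rewrite eqn_leq lemj andbT.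
have ltm1 : (m.-1 < m)%N by rewrite prednK.
exists (Ordinal ltm1), (Some true); split=> [i' p'|t].
  have := ltn_ord i'.
  by case: p' => [[|]|]; rewrite /= ?option_eqE ?eqxx /=; lia.
by rewrite /= jm flow_last addbF add1n prednK.
Qed.

Ltac nbr_simp :=
  rewrite ?unfold_in /= ?inE ?cat_vertex_eqE /spine_next ?option_eqE ?xpair_eqE
    ?option_eqE ?eqxx //=; try lia.
Ltac nbr_adj :=
  let k := fresh "k" in
  case=> [[k [[]|]]|[k [[[] [[]|]]|]]]; have := ltn_ord k; nbr_simp.
Ltac nbr_ker :=
  let t := fresh "t" in move=> t; rewrite /= ?add0n ?add1n;
  repeat match goal with |- context [flow ?a ?b] => case: (flow a b) end;
  repeat match goal with |- context [fun_of_fin ?f ?x] => case: (f x) end;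
  try done.
Ltac nbr_auto := split; [nbr_simp | nbr_adj | nbr_simp | nbr_ker].

(* The boolean [c] is the diagonal entry of the matrix at [v]. *)
Lemma caterpillar_nbrs (v : caterpillar) : (0 < m)%N ->
  exists n1 n2 n3 : caterpillar, exists c : bool,
    [/\ uniq [:: n1; n2; n3], adj v =i [:: n1; n2; n3], adj n1 n2 &
        forall t, kernel_vector t n1 (+) kernel_vector t n2 (+) kernel_vector t n3
                  = c && kernel_vector t v].
Proof.
move=> m_gt0; case: v => [[i [[|]|]]|[j [[s p]|]]].
(* The first two neighbors share a triangle with [v]. At a port, the diagonal entry is [true]
   exactly when the outer neighbor is a gadget root, whose value is 0. *)
- have [ltim|leim] := ltnP i.+1 m.
    exists (inl (i, Some false)), (inl (i, None)),
      (inl (Ordinal ltim, Some false)), false.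
    by nbr_auto.
  have mi : i.+1 = m by apply/eqP; rewrite eqn_leq ltn_ord.
  exists (inl (i, Some false)), (inl (i, None)), (inr (ord_max, None)), true.
  by nbr_auto.
- case: i => [[|i] ltim].
    exists (inl (Ordinal ltim, Some true)), (inl (Ordinal ltim, None)),
      (inr (ord0, None)), true.
    by nbr_auto.
  exists (inl (Ordinal ltim, Some true)), (inl (Ordinal ltim, None)),
    (inl (Ordinal (ltnW ltim), Some true)), false.
  by nbr_auto.
- have ltim : (i.+1 < m.+2)%N by rewrite ltnS; exact: leqW (ltn_ord i).
  exists (inl (i, Some true)), (inl (i, Some false)),
    (inr (Ordinal ltim, None)), true.
  by nbr_auto.
- case: p => [[|]|].
  + exists (inr (j, Some (s, Some false))), (inr (j, Some (~~ s, Some true))),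
      (inr (j, Some (~~ s, Some false))), true.
    by case: s; nbr_auto.
  + exists (inr (j, Some (s, Some true))), (inr (j, Some (~~ s, Some true))),
      (inr (j, Some (s, None))), true.
    by case: s; nbr_auto.
  + exists (inr (j, None)), (inr (j, Some (~~ s, None))),
      (inr (j, Some (s, Some false))), false.
    by case: s; nbr_auto.
- have [i [p [ip ip_ker]]] := gadget_attached j m_gt0.
  exists (inr (j, Some (false, None))), (inr (j, Some (true, None))),
    (inl (i, p)), false.
  split; [by nbr_simp | | by nbr_simp | ].
    by case=> [[i' p']|[j' [[[] [[]|]]|]]]; rewrite ?unfold_in /= ?ip; nbr_simp.
  by move=> t; rewrite ip_ker; move: t; nbr_ker.
Qed.

Lemma caterpillar_cubic : (0 < m)%N -> cubic caterpillar.
Proof.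
move=> m_gt0; apply: cubicP => v.
by have [n1 [n2 [n3 [c [Un Dn _ _]]]]] := caterpillar_nbrs v m_gt0; exists n1, n2, n3.
Qed.

Lemma caterpillar_claw_free : (0 < m)%N -> claw_free caterpillar.
Proof.
move=> m_gt0; apply: cubic_claw_free (caterpillar_cubic m_gt0) _ => v.
have [n1 [n2 [n3 [c [_ Dn n12 _]]]]] := caterpillar_nbrs v m_gt0.
by exists n1, n2; split=> //; have:= Dn n1; have:= Dn n2; rewrite !inE !eqxx ?orbT.
Qed.

Lemma caterpillar_zero_forcing : (0 < m)%N ->
  (3 * m + 5 <= zero_forcing_number caterpillar)%N.
Proof.
move=> m_gt0; have [S zfS ->] := zero_forcing_numberP caterpillar.
rewrite -(leq_exp2l _ _ (ltnSn 1)) -card_param.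
apply: leq_card_zero_forcing zfS => [t t'|t t' v u].
  exact: kernel_vector_inj.
have [n1 [n2 [n3 [c [/= + Dn _ ker]]]]] := caterpillar_nbrs v m_gt0.
rewrite !inE => /and3P [/norP [n12 n13] n23 _].
move=> vu eqv eqw; have := ker t; have := ker t'; rewrite -eqv => <-.
have eq_n n : n \in [:: n1; n2; n3] -> n != u ->
    kernel_vector t n = kernel_vector t' n.
  by rewrite -Dn; apply: eqw.
have: u \in [:: n1; n2; n3] by rewrite -Dn.
(* All terms of the equation at [v] except the one at [u] agree for [t] and [t'], and cancel. *)
rewrite !inE => /or3P [] /eqP Du; rewrite Du in eq_n *.
- rewrite (eq_n n2) ?(eq_n n3) ?inE ?eqxx ?orbT // 1?eq_sym //.
  by move/addIb/addIb.
- rewrite (eq_n n1) ?(eq_n n3) ?inE ?eqxx ?orbT // 1?eq_sym //.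
  by move/addIb/addbI.
- rewrite (eq_n n1) ?(eq_n n2) ?inE ?eqxx ?orbT // 1?eq_sym //.
  by move/addbI.
Qed.

Lemma caterpillar_connected : (0 < m)%N -> connected caterpillar.
Proof.
move=> m_gt0; pose v0 : caterpillar := inl (Ordinal m_gt0, Some false).
split; first by apply/card_gt0P; exists v0.
suff to_v0 (v : caterpillar) : connect (@adj caterpillar) v v0.
  move=> x y; apply: connect_trans (to_v0 x) _.
  by rewrite (sym_connect_sym (@adj_sym caterpillar)).
have step (u w : caterpillar) :
    adj w u -> connect (@adj caterpillar) u v0 -> connect (@adj caterpillar) w v0.
  by move=> wu; apply: connect_trans (connect1 wu).
(* Walk left along the spine; every other vertex is then at most a few steps from some left port. *)
have left_v0 (i : nat) (ltim : (i < m)%N) :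
    connect (@adj caterpillar) (inl (Ordinal ltim, Some false)) v0.
  elim: i ltim => [|i IH] ltim.
    by rewrite (bool_irrelevance ltim m_gt0) connect0.
  apply: (step (inl (Ordinal (ltnW ltim), Some true))); first by nbr_simp.
  by apply: step (IH (ltnW ltim)); nbr_simp.
have tri_v0 i p : connect (@adj caterpillar) (inl (i, p)) v0.
  case: i => i ltim; case: p => [[|]|] //; by apply: step (left_v0 i ltim); nbr_simp.
have att_v0 j : connect (@adj caterpillar) (inr (j, None)) v0.
  have [i [p [ip _]]] := gadget_attached j m_gt0.
  by apply: step (tri_v0 i p); rewrite /= ip !eqxx.
have apex_v0 j s : connect (@adj caterpillar) (inr (j, Some (s, None))) v0.
  by apply: step (att_v0 j); rewrite /= eqxx.
have end_v0 j s : connect (@adj caterpillar) (inr (j, Some (s, Some false))) v0.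
  by apply: step (apex_v0 j s); rewrite /= !eqxx.
case: v => [[i p]|[j [[s [[|]|]]|]]] //.
by apply: step (end_v0 j s); rewrite /= eqxx.
Qed.

End Caterpillar.

Theorem mainTheorem3 :
  forall N : nat, exists G : sgraph,
    [/\ connected G, cubic G, claw_free G, (N <= #|G|)%N
      & (zero_forcing_number G)%:R > 3 / 10 * #|G|%:R :> rat].
Proof.
move=> N; exists (caterpillar N.+1); split.
- exact: caterpillar_connected.
- exact: caterpillar_cubic.
- exact: caterpillar_claw_free.
- by rewrite card_caterpillar; lia.
(* With n = 10m + 14, one has 3n/10 = 3m + 4.2 < 3m + 5. *)
have := caterpillar_zero_forcing (ltn0Sn N).
rewrite -(ler_nat rat) card_caterpillar !natrD !natrM.
lra.
Qed.
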